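(* Let $n,p,B\ge 1$ be integers with $B$ dividing $n$, and let $\mathbf{y}=\mathbf{X}\boldsymbol{\beta}_*+\boldsymbol{\eta}$ with $\mathbf{X}\in\mathbb{R}^{n\times p}$, $\boldsymbol{\beta}_*\in\mathbb{R}^p$, $\boldsymbol{\eta}\in\mathbb{R}^n$. Let $\bar{\boldsymbol{\beta}}_k\in\mathbb{R}^p$ be the mean iterate after $k$ epochs of mini-batch gradient descent with random reshuffling, with $B$ mini-batches, step size $\alpha\ge 0$ and initialization $\boldsymbol{\beta}_0\in\mathbb{R}^p$. Let $\widetilde{\mathbf{X}}\in\mathbb{R}^{n\times p}$ be the matrix of modified features and $\mathbf{Z}=\frac1n\widetilde{\mathbf{X}}^{\mathsf T}\mathbf{X}$, and assume that $\mathrm{Range}(\widetilde{\mathbf{X}}^{\mathsf T})\subseteq \mathrm{Range}(\widetilde{\mathbf{X}}^{\mathsf T}\mathbf{X})$. Then for all $k\ge 0$, $$\bar{\boldsymbol{\beta}}_k-\boldsymbol{\beta}_* = (\mathbf{I}-B\alpha\mathbf{Z})^k(\boldsymbol{\beta}_0-\boldsymbol{\beta}_* )+\frac1n\left[\mathbf{I}-(\mathbf{I}-B\alpha\mathbf{Z})^k\right]\mathbf{Z}^{\dagger}\widetilde{\mathbf{X}}^{\mathsf T}\boldsymbol{\eta}.$$ Furthermore, if $\mathbf{P}_{\mathbf{Z},0}:=\mathbf{I}-\mathbf{Z}^\dagger\mathbf{Z}$ and $\mathbf{P}_{\mathbf{Z}}:=\mathbf{I}-\mathbf{P}_{\mathbf{Z},0}$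 denote the orthogonal projectors onto the nullspace and the row (or column) space of $\mathbf{Z}$ respectively, then $$(\mathbf{I}-B\alpha\mathbf{Z})^k(\boldsymbol{\beta}_0-\boldsymbol{\beta}_* )=\mathbf{P}_{\mathbf{Z},0}(\boldsymbol{\beta}_0-\boldsymbol{\beta}_* )+(\mathbf{I}-B\alpha\mathbf{Z})^k\mathbf{P}_{\mathbf{Z}}(\boldsymbol{\beta}_0-\boldsymbol{\beta}_* ).$$
   Context: Mini-batches: the $n$ rows of $\mathbf{X}$ are partitioned into $B$ fixed groups of size $n/B$, giving $\mathbf{X}_1,\dots,\mathbf{X}_B\in\mathbb{R}^{(n/B)\times p}$; $\mathbf{y}_b$ and $\boldsymbol{\eta}_b$ are the corresponding subvectors of $\mathbf{y}$ and $\boldsymbol{\eta}$. Put $\mathbf{W}_b:=\frac{B}{n}\mathbf{X}_b^{\mathsf T}\mathbf{X}_b$. Algorithm (mini-batch gradient descent with random reshuffling): in each epoch $k=1,2,\dots$ a permutation $\tau$ is drawn uniformly from the set $S_B$ of permutations of $\{1,\dots,B\}$, independently across epochs, and $$\boldsymbol{\beta}_k^{(b)}=\boldsymbol{\beta}_k^{(b-1)}-\frac{B\alpha}{n}\mathbf{X}_{\tau(b)}^{\mathsf T}\big(\mathbf{X}_{\tau(b)}\boldsymbol{\beta}_k^{(b-1)}-\mathbf{y}_{\tau(b)}\big),\quad b=1,\dots,B,$$ with $\boldsymbol{\beta}_k^{(0)}:=\boldsymbol{\beta}_{k-1}^{(B)}$ and $\boldsymbol{\beta}_0^{(B)}:=\boldsymbol{\beta}_0$.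 The mean iterate is $\bar{\boldsymbol{\beta}}_k:=\mathbb{E}[\boldsymbol{\beta}_k^{(B)}]$, the expectation being over the random permutations of all epochs only ($\mathbf{X}$ and $\boldsymbol{\eta}$ are held fixed). Modified features: for each $b$, $$\Pi_b:=\frac{1}{B!}\sum_{\tau\in S_B}\ \prod_{j:\,j<\tau^{-1}(b)}(\mathbf{I}-\alpha\mathbf{W}_{\tau(j)}),$$ where the factors are multiplied from right to left in increasing order of $j$ (the factor $j=1$ is rightmost), and an empty product is $\mathbf{I}$. Set $\widetilde{\mathbf{X}}_b:=\mathbf{X}_b\Pi_b$, and let $\widetilde{\mathbf{X}}\in\mathbb{R}^{n\times p}$ be the concatenation of the $\widetilde{\mathbf{X}}_b$, with rows placed as in the original partition of $\mathbf{X}$. Thus $\mathbf{Z}=\frac1n\widetilde{\mathbf{X}}^{\mathsf T}\mathbf{X}=\frac1n\sum_{b=1}^B\Pi_b\mathbf{X}_b^{\mathsf T}\mathbf{X}_b$; it is a symmetric matrix. $\mathrm{Range}(\cdot)$ is the column space and $(\cdot)^\dagger$ the Moore–Penrose pseudoinverse. *)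

(* Defs.v *)
From HB Require Import structures.
From mathcomp Require Import all_boot all_order all_algebra all_fingroup.
From mathcomp Require Import all_classical all_reals all_analysis.

Set Implicit Arguments.
Unset Strict Implicit.
Unset Printing Implicit Defensive.

Import Order.TTheory GRing.Theory Num.Theory.

Local Open Scope classical_set_scope.
Local Open Scope ring_scope.

Section LinearAlgebra.
Context {R : realFieldType}.

(* Matrices act on column vectors, unlike in mxalgebra. *)
Definition Range m n (A : 'M[R]_(m, n)) : set 'cV[R]_m :=
  range (fun v : 'cV[R]_n => A *m v).

Definition Null m n (A : 'M[R]_(m, n)) : set 'cV[R]_n :=
  [set v | A *m v = 0].

Definition orthogonal_projector n (Q : 'M[R]_n) (V : set 'cV[R]_n) : Prop :=
  [/\ Q^T = Q, Q *m Q = Q & Range Q = V].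

(* The Penrose equations. *)
Definition penrose m n (A : 'M[R]_(m, n)) (G : 'M[R]_(n, m)) : Prop :=
  [/\ A *m G *m A = A, G *m A *m G = G,
      (A *m G)^T = A *m G & (G *m A)^T = G *m A].

Lemma penrose_unique m n (A : 'M[R]_(m, n)) (G H : 'M[R]_(n, m)) :
  penrose A G -> penrose A H -> G = H.
Proof.
move=> [AGA GAG sAG sGA] [AHA HAH sAH sHA].
have EA : A *m G = A *m H.
  rewrite -sAG -[in LHS]AHA -(mulmxA (A *m H)) trmx_mul sAG sAH.
  by rewrite mulmxA AGA.
have EB : G *m A = H *m A.
  rewrite -sGA -[in LHS]AHA -mulmxA mulmxA trmx_mul sHA sGA.
  by rewrite mulmxA in AGA *; rewrite -!mulmxA (mulmxA A) AGA.
by rewrite -GAG EB -mulmxA EA mulmxA HAH.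
Qed.

Lemma gram_unit m n (F : 'M[R]_(m, n)) : row_free F -> F *m F^T \in unitmx.
Proof.
move=> Ffree; rewrite -row_free_unit; apply/row_freeP.
have inj (u : 'rV_m) : u *m (F *m F^T) = 0 -> u = 0.
  move=> u0; have w0 : (u *m F) *m (u *m F)^T = 0.
    by rewrite trmx_mul mulmxA -(mulmxA u) u0 mul0mx.
  suff uF : u *m F = 0 by apply/eqP; rewrite -(mulmx_free_eq0 u Ffree) uF.
  apply/rowP => j; rewrite [RHS]mxE; apply/eqP.
  suff: (u *m F) 0 j ^+ 2 == 0 by rewrite expf_eq0.
  move/matrixP/(_ 0 0): w0; rewrite mxE [RHS]mxE => /eqP.
  rewrite psumr_eq0 => [|i _]; last by rewrite [X in _ * X]mxE -expr2 sqr_ge0.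
  by move/allP/(_ j); rewrite mem_index_enum [X in _ * X]mxE -expr2 => /(_ isT).
apply/row_freeP; rewrite -kermx_eq0; apply/eqP/row_matrixP => i.
by rewrite row0; apply: inj; rewrite -row_mul mulmx_ker row0.
Qed.

Lemma penrose_full_rank m n r (C : 'M[R]_(m, r)) (F : 'M[R]_(r, n)) :
  row_free C^T -> row_free F -> exists G, penrose (C *m F) G.
Proof.
move=> /gram_unit; rewrite trmxK => uC /gram_unit uF.
pose L := invmx (C^T *m C) *m C^T; pose K := F^T *m invmx (F *m F^T).
have LC : L *m C = 1%:M by rewrite -mulmxA mulVmx.
have FK : F *m K = 1%:M by rewrite mulmxA mulmxV.
have AG : C *m F *m (K *m L) = C *m L by rewrite mulmxA -(mulmxA C) FK mulmx1.
have GA : K *m L *m (C *m F) = K *m F by rewrite mulmxA -(mulmxA K) LC mulmx1.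
exists (K *m L); split.
- by rewrite AG mulmxA -(mulmxA C) LC mulmx1.
- by rewrite GA mulmxA -(mulmxA K) FK mulmx1.
- by rewrite AG /L !trmx_mul trmx_inv trmx_mul trmxK mulmxA.
- by rewrite GA /K !trmx_mul trmx_inv trmx_mul trmxK mulmxA.
Qed.

Lemma penrose_exists m n (A : 'M[R]_(m, n)) : exists G, penrose A G.
Proof.
have := @penrose_full_rank _ _ _ (col_base A) (row_base A).
rewrite mulmx_base; apply; last exact: row_base_free.
by have := col_base_full A; rewrite /row_free /row_full mxrank_tr.
Qed.

Definition mp_inv m n (A : 'M[R]_(m, n)) : 'M[R]_(n, m) := xget 0 (penrose A).

Lemma mp_invP m n (A : 'M[R]_(m, n)) : penrose A (mp_inv A).
Proof. by apply: xgetPex; apply: penrose_exists. Qed.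

End LinearAlgebra.

(* A partition of the n rows into B groups of n %/ B rows, together with an
   order of the rows inside each group: row_of (b, i) is the row of X that is
   the i-th row of batch b. *)
Record batch_partition (n B : nat) := BatchPartition {
  row_of : 'I_B * 'I_(n %/ B) -> 'I_n;
  slot_of : 'I_n -> 'I_B * 'I_(n %/ B);
  row_ofK : cancel row_of slot_of;
  slot_ofK : cancel slot_of row_of }.

Definition batch (T : Type) (n B p : nat) (part : batch_partition n B)
    (X : 'M[T]_(n, p)) (b : 'I_B) : 'M[T]_(n %/ B, p) :=
  rowsub (fun i => row_of part (b, i)) X.

Section MiniBatch.
Context {R : realFieldType} {n B p : nat}.
Variables (part : batch_partition n B) (X : 'M[R]_(n, p)) (alpha : R).

Section Algorithm.
Variable y : 'cV[R]_n.

Definition batch_step (b : 'I_B) (beta : 'cV[R]_p) : 'cV[R]_p :=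
  beta - (B%:R * alpha / n%:R) *:
    ((batch part X b)^T *m (batch part X b *m beta - batch part y b)).

(* One epoch: the batches tau 0, tau 1, ... are used in this order. *)
Definition epoch (tau : 'S_B) (beta : 'cV[R]_p) : 'cV[R]_p :=
  foldl (fun v (j : 'I_B) => batch_step (tau j) v) beta (enum 'I_B).

(* The iterate at the end of epoch k; tau i is the permutation of the
   (i+1)-st epoch. *)
Fixpoint iterate (tau : nat -> 'S_B) (beta0 : 'cV[R]_p) (k : nat) : 'cV[R]_p :=
  if k is k'.+1 then epoch (tau k') (iterate tau beta0 k') else beta0.

End Algorithm.

Definition Wb (b : 'I_B) : 'M[R]_p :=
  (B%:R / n%:R) *: ((batch part X b)^T *m batch part X b).

(* The list is reversed so that the factor with the smallest index is the
   rightmost one. *)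
Definition Pi_ (b : 'I_B) : 'M[R]_p :=
  (B`!%:R)^-1 *: \sum_(tau : 'S_B)
    \big[mulmx/1%:M]_(j <- rev (enum 'I_B) | (j < (tau^-1)%g b)%N)
      (1%:M - alpha *: Wb (tau j)).

Definition Xtilde_batch (b : 'I_B) : 'M[R]_(n %/ B, p) :=
  batch part X b *m Pi_ b.

Definition Xtilde : 'M[R]_(n, p) :=
  \matrix_(i, j) Xtilde_batch (slot_of part i).1 (slot_of part i).2 j.

Definition Zmx : 'M[R]_p := (n%:R)^-1 *: (Xtilde^T *m X).

End MiniBatch.

Section RandomReshuffling.
Context {d : measure_display} {T : measurableType d} {R : realType}.
Variable P : probability T R.

(* Mutual independence of a sequence of finitely-valued random variables. *)
Definition independent_seq (S : finType) (tau : nat -> T -> S) : Prop :=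
  forall (J : seq nat) (A : nat -> set S), uniq J ->
    fine (P (\bigcap_(i in [set` J]) (tau i @^-1` A i))) =
    \prod_(i <- J) fine (P (tau i @^-1` A i)).

(* A sequence of independent random variables, uniform on the finite type S,
   which carries the discrete sigma-algebra. *)
Definition iid_uniform (S : finType) (tau : nat -> T -> S) : Prop :=
  [/\ forall i (A : set S), measurable (tau i @^-1` A),
      forall i s, P (tau i @^-1` [set s]) = ((#|S|%:R)^-1)%:E
    & independent_seq tau].

Definition mean_iterate n B p (part : batch_partition n B) (X : 'M[R]_(n, p))
    (alpha : R) (y : 'cV[R]_n) (tau : nat -> T -> 'S_B) (beta0 : 'cV[R]_p)
    (k : nat) : 'cV[R]_p :=
  \col_j fine 'E_P[fun w => iterate part X alpha y (tau ^~ w) beta0 k j 0].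

End RandomReshuffling.

(* Main.v *)
Require Import Defs.
From mathcomp Require Import all_boot all_order all_algebra all_fingroup.
From mathcomp Require Import all_classical all_reals all_analysis.

(* One epoch along tau is affine: with A_b := I - alpha W_b and r := y - X beta it
   maps beta to beta plus the sum over the positions j of
     (prod of A_(tau i), i > j) (B alpha / n) X_(tau j)^T r_(tau j).
   Averaging over tau and reading each permutation backwards turns the factors
   after position j into the transposed factors before it, so the mean epoch is
   beta |-> beta + (B alpha / n) Xtilde^T (y - X beta).  As the epochs are
   independent, the mean iterate follows this affine recursion, which is solved
   by induction; the range hypothesis gives Z Z^+ Xtilde^T eta = Xtilde^T eta.
   The symmetry of Z for alpha <> 0 comes from the same reversal: I - B alpha Z
   is the average over tau of the full products of the symmetric A_(tau i). *)

Set Implicit Arguments.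
Unset Strict Implicit.
Unset Printing Implicit Defensive.

Import Order.TTheory GRing.Theory Num.Theory.

Local Open Scope classical_set_scope.
Local Open Scope ring_scope.

(** * Expectations of functions of finitely many epochs *)

Lemma fine_expectation_finite d (T : measurableType d) (R : realType)
    (P : probability T R) (S : finType) (Y : T -> S) (g : S -> R) :
  (forall s, measurable (Y @^-1` [set s])) ->
  fine 'E_P[fun w => g (Y w)] = \sum_s g s * fine (P (Y @^-1` [set s])).
Proof.
move=> mY; rewrite unlock.
rewrite (eq_integral (fun w => \sum_s (g s)%:E * (\1_(Y @^-1` [set s]) w)%:E)%E).
  rewrite integral_sum//; last first.
    by move=> s; apply: integrableZl => //; exact: integrable_indic.
  transitivity (fine (\sum_s (g s * fine (P (Y @^-1` [set s])))%:E)%E); last first.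
    by rewrite sumEFin.
  congr fine; apply: eq_bigr => s _; rewrite integralZl//; last exact: integrable_indic.
  by rewrite integral_indic// setIT EFinM fineK// fin_num_measure.
move=> w _; rewrite (bigD1 (Y w))//= big1 ?adde0 => [|s sY].
  by rewrite indicE mem_set//= mule1.
by rewrite indicE memNset ?mule0//= => /eqP; rewrite eq_sym (negPf sY).
Qed.

(* Most recent value first. *)
Fixpoint history (S : Type) (u : nat -> S) (k : nat) : k.-tuple S :=
  if k is k'.+1 then [tuple of u k' :: history u k'] else [tuple].

(** Puts the event of a prescribed history in the coordinatewise form that [independent_seq]
    handles. Epoch [i] sits at position [k - i.+1], so the default [u i] is never reached. *)
Lemma history_eqP (S : eqType) (u : nat -> S) k (t : k.-tuple S) :
  history u k = t <-> forall i, (i < k)%N -> nth (u i) t (k - i.+1) = u i.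
Proof.
elim: k t => [|k IH] t; first by rewrite [t]tuple0; split.
case/tupleP: t => s t; split.
  move=> /(congr1 val)[us /val_inj/IH ut] i; rewrite ltnS leq_eqVlt => /predU1P[->|ik].
    by rewrite subnn.
  by rewrite subSn//= ut.
move=> ut; have := ut k (ltnSn k); rewrite subnn /= => <-.
congr [tuple of _ :: _]; apply/IH => i ik.
by have := ut i (ltnW ik); rewrite subSn.
Qed.

Lemma history_preimage (T S : Type) (tau : nat -> T -> S) k (s : S) (t : k.-tuple S) :
  (fun w => history (tau ^~ w) k.+1) @^-1` [set [tuple of s :: t]] =
  tau k @^-1` [set s] `&` (fun w => history (tau ^~ w) k) @^-1` [set t].
Proof.
apply/seteqP; split=> w /=; first by move=> /(congr1 val)[-> /val_inj ->].
by case=> <- <-.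
Qed.

Section UniformHistory.
Context d (T : measurableType d) (R : realType) (P : probability T R).
Variables (S : finType) (tau : nat -> T -> S).
Hypothesis htau : iid_uniform P tau.

Lemma measurable_history k (t : k.-tuple S) :
  measurable ((fun w => history (tau ^~ w) k) @^-1` [set t]).
Proof.
have [mtau _ _] := htau.
elim: k t => [|k IH] t.
  rewrite [X in measurable X](_ : _ = setT)//.
  by apply/seteqP; split=> // w _ /=; rewrite [t]tuple0.
by case/tupleP: t => s t; rewrite history_preimage; exact: measurableI.
Qed.

Lemma history_uniform k (t : k.-tuple S) :
  fine (P ((fun w => history (tau ^~ w) k) @^-1` [set t])) = (#|S|%:R ^+ k)^-1.
Proof.
have [_ utau itau] := htau.
(* Using [s] as its own default avoids choosing an element of [S]; for [i < k] the index is in range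
   and [A i] is a singleton. *)
pose A i := [set s | nth s t (k - i.+1) = s].
rewrite (_ : _ @^-1` _ = \bigcap_(i in [set` iota 0 k]) (tau i @^-1` A i)).
  rewrite itau ?iota_uniq// (eq_big_seq (fun=> #|S|%:R^-1 : R)).
    by rewrite big_const_seq count_predT size_iota iter_mulr_1 exprVn.
  move=> i; rewrite mem_iota add0n => /= ik.
  have lt : (k - i.+1 < size t)%N by rewrite size_tuple subnSK// leq_subr.
  have [s0] : inhabited S by constructor; exact: (tnth t (Ordinal ik)).
  rewrite (_ : A i = [set nth s0 t (k - i.+1)]) ?utau//.
  by apply/seteqP; split=> s /=; rewrite /A /= (set_nth_default s0).
apply/seteqP; split=> w /=.
  by move/history_eqP => wt i /=; rewrite mem_iota => /= /wt.
by move=> wt; apply/history_eqP => i ik; apply: wt; rewrite /= mem_iota.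
Qed.

Lemma fine_expectation_history k (g : k.-tuple S -> R) :
  fine 'E_P[fun w => g (history (tau ^~ w) k)] =
  (#|S|%:R ^+ k)^-1 * \sum_t g t.
Proof.
rewrite fine_expectation_finite; last exact: measurable_history.
rewrite mulr_sumr; apply: eq_bigr => t _.
by rewrite history_uniform mulrC.
Qed.

End UniformHistory.

(** * Sums over tuples and permutations, and reversed products *)

Lemma big_tupleS (V : nmodType) (S : finType) k (F : k.+1.-tuple S -> V) :
  \sum_t F t = \sum_(t : k.-tuple S) \sum_s F [tuple of s :: t].
Proof.
rewrite pair_bigA/=.
rewrite (reindex (fun x : k.-tuple S * S => [tuple of x.2 :: x.1]))//=.
exists (fun t : k.+1.-tuple S => ([tuple of behead t], thead t)).
  by case=> t s _ /=; congr pair; apply: val_inj.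
by case/tupleP=> s t _ /=; apply: val_inj.
Qed.

(** The first [k] permutations determine the iterate; [foldr] applies the head last, which fits a
    history with the latest epoch in front. *)
Lemma iterate_history (R : realFieldType) n B p (part : batch_partition n B)
    (X : 'M[R]_(n, p)) alpha y tau beta0 k :
  iterate part X alpha y tau beta0 k =
  foldr (epoch part X alpha y) beta0 (history tau k).
Proof. by elim: k => //= k ->. Qed.

Lemma eq_mulmx_cV (R : pzSemiRingType) m p (M N : 'M[R]_(m, p)) :
  (forall v : 'cV[R]_p, M *m v = N *m v) -> M = N.
Proof.
move=> MN; apply/matrixP => i j.
by have := congr1 (fun u : 'cV_m => u i 0) (MN (delta_mx j 0)); rewrite -!colE !mxE.
Qed.

Lemma rev_enum_ord n : rev (enum 'I_n) = map (@rev_ord n) (enum 'I_n).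
Proof.
apply: (inj_map val_inj); rewrite map_rev val_enum_ord -map_comp.
apply: (@eq_from_nth _ 0%N) => [|i].
  by rewrite size_rev size_iota size_map size_enum_ord.
rewrite size_rev size_iota => ilt.
rewrite nth_rev ?size_iota// nth_iota; last by rewrite subnSK// leq_subr.
rewrite (nth_map (Ordinal ilt)) ?size_enum_ord//=.
by rewrite nth_enum_ord.
Qed.

Lemma trmx_big_mulmx (R : comPzSemiRingType) p (I : Type) (r : seq I) (Q : pred I)
    (F : I -> 'M[R]_p) :
  (\big[mulmx/1%:M]_(i <- r | Q i) F i)^T =
  \big[mulmx/1%:M]_(i <- rev r | Q i) (F i)^T.
Proof.
have trM (M N : 'M[R]_p) : (M * N)^T = N^T * M^T by exact: trmx_mul.
rewrite mulmxE -[X in bigop X _ _]/(1 : 'M[R]_p).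
elim: r => [|i r IH]; first by rewrite !big_nil trmx1.
rewrite big_cons rev_cons big_rcons/= -IH.
by case: (Q i); rewrite ?trM ?[_ * 1%:M]mulmx1.
Qed.

(** The left factor of a product of permutations acts first, so the new summation variable is [tau]
    read from its last position to its first. *)
Lemma sum_perm_rev (V : nmodType) B (F : 'S_B -> V) :
  \sum_tau F tau = \sum_tau F (perm (@rev_ord_inj B) * tau)%g.
Proof. by rewrite (reindex_inj (@mulgI _ (perm (@rev_ord_inj B)))). Qed.


(** * The mean epoch and the symmetry of Z *)

Section MeanEpoch.
Context {R : realFieldType} {n B p : nat}.
Variables (part : batch_partition n B) (X : 'M[R]_(n, p)) (alpha : R).

Let A b : 'M[R]_p := 1%:M - alpha *: Wb part X b.

Lemma tr_Wb b : (Wb part X b)^T = Wb part X b.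
Proof. by rewrite /Wb linearZ/= trmx_mul trmxK. Qed.

Lemma tr_contraction b : (A b)^T = A b.
Proof. by rewrite /A linearB/= trmx1 linearZ/= tr_Wb. Qed.

Definition batch_push (b : 'I_B) (r : 'cV[R]_n) : 'cV[R]_p :=
  (B%:R * alpha / n%:R) *: ((batch part X b)^T *m batch part r b).

Lemma batch_mulmx b (beta : 'cV[R]_p) :
  batch part (X *m beta) b = batch part X b *m beta.
Proof. by rewrite /batch -mul_rowsub_mx. Qed.

Lemma batchD b (u v : 'cV[R]_n) : batch part (u + v) b = batch part u b + batch part v b.
Proof. by apply/matrixP=> i j; rewrite !mxE. Qed.

Lemma batchN b (u : 'cV[R]_n) : batch part (- u) b = - batch part u b.
Proof. by apply/matrixP=> i j; rewrite !mxE. Qed.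

(** The gradient is affine, so centring at any reference point [beta] leaves a linear part and a
    constant push. Both the start of the epoch and 0 serve as [beta] below. *)
Lemma batch_stepE y b (beta v : 'cV[R]_p) :
  batch_step part X alpha y b v - beta =
  A b *m (v - beta) + batch_push b (y - X *m beta).
Proof.
rewrite /batch_step /batch_push /A /Wb batchD batchN batch_mulmx.
rewrite mulmxBl mul1mx scalerA -scalemxAl.
have -> : alpha * (B%:R / n%:R) = B%:R * alpha / n%:R by rewrite mulrA [alpha * _]mulrC.
rewrite -mulmxA [LHS]addrAC -[RHS]addrA; congr (_ + _).
rewrite -!scalerN -scalerDr -!mulmxN -mulmxDr; congr (_ *: (_ *m _)).
by rewrite !opprB mulmxBr mulmxN [RHS]addrC subrKA.
Qed.

(** Induction from the right: a new last step multiplies all earlier pushes on the left by its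
    factor and adds its own push. Sortedness identifies [j < i] with [i] coming later in [l]. *)
Lemma foldl_batch_step y (tau : 'S_B) (beta : 'cV[R]_p) (l : seq 'I_B) :
  sorted (fun i j : 'I_B => (i < j)%N) l ->
  foldl (fun v j => batch_step part X alpha y (tau j) v) beta l - beta =
  \sum_(j <- l) \big[mulmx/1%:M]_(i <- rev l | (j < i)%N) A (tau i) *m
    batch_push (tau j) (y - X *m beta).
Proof.
elim/last_ind: l => [|l x IH]; first by rewrite /= big_nil subrr.
move=> lx.
have tr : transitive (fun i j : 'I_B => (i < j)%N) by move=> ? ? ?; exact: ltn_trans.
move: (lx); rewrite (sorted_pairwise tr) pairwise_rcons -(sorted_pairwise tr).
move=> /andP[/allP ltx /IH {}IH].
rewrite foldl_rcons batch_stepE IH big_rcons/=; congr (_ + _).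
- rewrite mulmx_sumr; apply: eq_big_seq => j /ltx jx.
  by rewrite rev_rcons big_cons jx -mulmxA.
(* The last position [x] is the largest, so the product in front of its push is empty. *)
- rewrite rev_rcons big_cons ltnn big_seq_cond big_pred0 ?mul1mx// => j.
  rewrite mem_rev; apply/negbTE/andP => -[/ltx jx /(ltn_trans jx)].
  by rewrite ltnn.
Qed.

Lemma epochE y (tau : 'S_B) beta :
  epoch part X alpha y tau beta = beta +
  \sum_(j : 'I_B) \big[mulmx/1%:M]_(i <- rev (enum 'I_B) | (j < i)%N) A (tau i) *m
    batch_push (tau j) (y - X *m beta).
Proof.
rewrite -(subrK beta (epoch _ _ _ _ _ _)) addrC; congr (_ + _).
rewrite /epoch foldl_batch_step; last first.
  by have := iota_ltn_sorted 0 B; rewrite -val_enum_ord sorted_map.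
by rewrite big_enum.
Qed.

(** Reversing [tau] carries the positions after that of [b] to those before it. The factors then
    come in the opposite order, which the transpose repairs because each [A b] is symmetric. *)
Lemma sum_suffix_products b :
  (B`!%:R)^-1 *: (\sum_(tau : 'S_B)
     \big[mulmx/1%:M]_(i <- rev (enum 'I_B) | ((tau^-1)%g b < i)%N) A (tau i))
  = (Pi_ part X alpha b)^T.
Proof.
rewrite sum_perm_rev /Pi_ linearZ/= [X in _ = _ *: X]raddf_sum/=; congr (_ *: _).
apply: eq_bigr => tau _.
rewrite trmx_big_mulmx revK rev_enum_ord big_map.
under [RHS]eq_bigr do rewrite tr_contraction.
apply: eq_big => [i|i _]; last by rewrite permM permE rev_ordK.
rewrite invMg permM.
have -> : ((perm (@rev_ord_inj B))^-1)%g ((tau^-1)%g b) = rev_ord ((tau^-1)%g b).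
  by apply: (@perm_inj _ (perm (@rev_ord_inj B))); rewrite permKV permE rev_ordK.
by rewrite /= ltn_sub2lE ?ltnS.
Qed.

(** The sum over rows splits by batch because [row_of] is a bijection. [V] is a residual in
    [mean_epoch] and [X] itself in [tr_Zmx]. *)
Lemma tr_Xtilde_mul q (V : 'M[R]_(n, q)) :
  (Xtilde part X alpha)^T *m V =
  \sum_b (Pi_ part X alpha b)^T *m ((batch part X b)^T *m batch part V b).
Proof.
apply/matrixP=> i j; rewrite summxE mxE.
rewrite (reindex (row_of part)); last first.
  by exists (slot_of part) => k _; rewrite ?row_ofK ?slot_ofK.
transitivity (\sum_(b < B) \sum_(k < n %/ B)
    Xtilde_batch part X alpha b k i * batch part V b k j).
  rewrite pair_bigA; apply: eq_bigr => -[b k] _ /=.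
  by rewrite !mxE row_ofK.
apply: eq_bigr => b _; rewrite mulmxA -trmx_mul mxE.
by apply: eq_bigr => k _; rewrite [in RHS]mxE.
Qed.

Lemma mean_epoch y beta :
  (B`!%:R)^-1 *: (\sum_(tau : 'S_B) epoch part X alpha y tau beta) =
  beta + (B%:R * alpha / n%:R) *: ((Xtilde part X alpha)^T *m (y - X *m beta)).
Proof.
under eq_bigr do rewrite epochE.
rewrite big_split/= scalerDr; congr (_ + _).
  by rewrite sumr_const card_Sn -scaler_nat scalerA mulVf ?scale1r.
set r := y - _.
(* Summing over the batch [b = tau j] instead of the position [j] makes the push independent of
   [tau], so that only the products are averaged. *)
under eq_bigr => tau _ do rewrite (reindex_perm (tau^-1)%g) /=.
rewrite exchange_big tr_Xtilde_mul !scaler_sumr; apply: eq_bigr => b _ /=.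
rewrite -sum_suffix_products scalemxAr -/(batch_push b r) -scalemxAl mulmx_suml.
by congr (_ *: _); apply: eq_bigr => tau _; rewrite permKV.
Qed.

Lemma epoch0 (tau : 'S_B) beta :
  epoch part X alpha 0 tau beta =
  (\big[mulmx/1%:M]_(i <- rev (enum 'I_B)) A (tau i)) *m beta.
Proof.
rewrite /epoch; elim/last_ind: (enum _) => [|l x IH].
  by rewrite big_nil mul1mx.
rewrite foldl_rcons rev_rcons big_cons -mulmxA -IH.
rewrite -[LHS]subr0 batch_stepE mulmx0 !subr0 /batch_push.
suff -> : batch part 0 (tau x) = 0 :> 'cV[R]_(n %/ B) by rewrite mulmx0 scaler0 addr0.
by apply/matrixP => i j; rewrite !mxE.
Qed.

(** Taking [y = 0] in [mean_epoch] isolates the linear part of the mean epoch, and both sides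
    compute it. *)
Lemma contraction_average :
  1%:M - (B%:R * alpha) *: Zmx part X alpha =
  (B`!%:R)^-1 *: \sum_(tau : 'S_B)
     \big[mulmx/1%:M]_(i <- rev (enum 'I_B)) A (tau i).
Proof.
apply: eq_mulmx_cV => beta; rewrite -scalemxAl mulmx_suml.
under [in RHS]eq_bigr do rewrite -epoch0.
rewrite mean_epoch sub0r mulmxBl mul1mx /Zmx scalerA -scalemxAl -mulmxA.
by rewrite mulmxN scalerN.
Qed.

(** Transposing a full product gives the one for the reversed permutation, and the average runs over
    all permutations. *)
Lemma tr_contraction_average :
  (1%:M - (B%:R * alpha) *: Zmx part X alpha)^T =
  1%:M - (B%:R * alpha) *: Zmx part X alpha.
Proof.
rewrite contraction_average linearZ/= raddf_sum/=; congr (_ *: _).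
rewrite [RHS]sum_perm_rev; apply: eq_bigr => tau _.
rewrite trmx_big_mulmx revK rev_enum_ord big_map.
by apply: eq_bigr => i _; rewrite tr_contraction permM permE rev_ordK.
Qed.

Lemma tr_Zmx : (0 < B)%N -> (Zmx part X alpha)^T = Zmx part X alpha.
Proof.
move=> B0; have [a0|a0] := eqVneq alpha 0; last first.
  have c0 : B%:R * alpha != 0 by rewrite mulf_neq0// pnatr_eq0 -lt0n.
  have := tr_contraction_average; rewrite linearB/= trmx1 linearZ/=.
  by move/addrI/oppr_inj/(scalerI c0).
(* For [alpha = 0] the averaged contraction says nothing about Z; here every [Pi_] is the identity
   and Z is a multiple of the Gram matrix of [X]. *)
rewrite /Zmx linearZ/= tr_Xtilde_mul raddf_sum/=; congr (_ *: _).
apply: eq_bigr => b _; suff -> : Pi_ part X alpha b = 1%:M.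
  by rewrite trmx1 mul1mx trmx_mul trmxK.
rewrite /Pi_ (eq_bigr (fun=> 1%:M)) => [|tau _].
  by rewrite sumr_const card_Sn -scaler_nat scalerA mulVf ?scale1r.
apply: (big_rec (fun M => M = 1%:M)) => // i M _ ->.
by rewrite mulmx1 a0 scale0r subr0.
Qed.

End MeanEpoch.

(** * Orthogonal projectors built from the pseudoinverse *)

Section MoorePenroseProjectors.
Context {R : realFieldType} {p : nat}.
Variable Z : 'M[R]_p.

Lemma mulmx_null_projector : Z *m (1%:M - mp_inv Z *m Z) = 0.
Proof. by have [ZGZ _ _ _] := mp_invP Z; rewrite mulmxBr mulmx1 mulmxA ZGZ subrr. Qed.

Lemma null_projectorP :
  orthogonal_projector (1%:M - mp_inv Z *m Z) (Null Z).
Proof.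
have [ZGZ GZG _ sGZ] := mp_invP Z; split.
- by rewrite linearB/= trmx1 sGZ.
- by rewrite mulmxBl mul1mx -mulmxA mulmx_null_projector mulmx0 subr0.
- apply/seteqP; split=> [_ [v _ <-]|v Zv] /=.
    by rewrite /Null /= mulmxA mulmx_null_projector mul0mx.
  by exists v => //=; rewrite mulmxBl mul1mx -mulmxA Zv mulmx0 subr0.
Qed.

(** Symmetry of [mp_inv Z *m Z] brings [Z^T] to the front for one inclusion; the transposed first
    Penrose equation shows that [Z^T] is fixed for the other. *)
Lemma row_projectorP : orthogonal_projector (mp_inv Z *m Z) (Range Z^T).
Proof.
have [ZGZ GZG _ sGZ] := mp_invP Z; split=> //.
- by rewrite mulmxA GZG.
- apply/seteqP; split=> [_ [v _ <-]|_ [v _ <-]] /=.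
    by exists ((mp_inv Z)^T *m v) => //=; rewrite mulmxA -trmx_mul sGZ.
  by exists (Z^T *m v) => //=; rewrite mulmxA -{1}sGZ -trmx_mul mulmxA ZGZ.
Qed.

End MoorePenroseProjectors.

Lemma mulmx_expr_fix (R : pzRingType) p q (M : 'M[R]_p) (V : 'M[R]_(p, q)) k :
  M *m V = V -> M ^+ k *m V = V.
Proof.
move=> MV; elim: k => [|k IH]; first by rewrite expr0 mul1mx.
by rewrite exprSr -mulmxE -mulmxA MV.
Qed.

(** * The affine recursion of the mean iterate *)

Section MeanIterate.
Context {d : measure_display} {T : measurableType d} {R : realType}.
Variables (P : probability T R) (n B p : nat) (part : batch_partition n B).
Variables (X : 'M[R]_(n, p)) (alpha : R) (y : 'cV[R]_n).
Variables (tau : nat -> T -> 'S_B) (beta0 : 'cV[R]_p).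
Hypothesis htau : iid_uniform P tau.

Lemma mean_iterateE k :
  mean_iterate P part X alpha y tau beta0 k =
  (#|{perm 'I_B}|%:R ^+ k)^-1 *:
    \sum_(t : k.-tuple 'S_B) foldr (epoch part X alpha y) beta0 t.
Proof.
apply/colP => j; rewrite !mxE summxE.
under eq_fun do rewrite iterate_history.
exact: (fine_expectation_history htau
  (fun t : k.-tuple 'S_B => foldr (epoch part X alpha y) beta0 t j 0)).
Qed.

Lemma mean_iterate0 : mean_iterate P part X alpha y tau beta0 0 = beta0.
Proof.
rewrite mean_iterateE expr0 invr1 scale1r (big_pred1 [tuple]) // => t.
by rewrite [t]tuple0; apply/esym/eqP.
Qed.

(** For a fixed history, averaging over the newest permutation is a mean epoch; this map is affine,
    so it commutes with averaging over histories. *)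
Lemma mean_iterateS k (beta := mean_iterate P part X alpha y tau beta0 k) :
  mean_iterate P part X alpha y tau beta0 k.+1 =
  beta + (B%:R * alpha / n%:R) *: ((Xtilde part X alpha)^T *m (y - X *m beta)).
Proof.
pose c : R := #|{perm 'I_B}|%:R ^+ k.
have c0 : c != 0 by rewrite expf_neq0// card_Sn pnatr_eq0 -lt0n fact_gt0.
pose f (t : k.-tuple 'S_B) := foldr (epoch part X alpha y) beta0 t.
have -> : beta = c^-1 *: \sum_t f t by rewrite /beta mean_iterateE.
(* There are [c] histories, so averaging the constant [y] over them returns [y]. *)
have -> : y - X *m (c^-1 *: \sum_t f t) = c^-1 *: \sum_t (y - X *m f t).
  rewrite sumrB -mulmx_sumr scalerBr scalemxAr sumr_const card_tuple.
  by rewrite -scaler_nat scalerA natrX mulVf// scale1r.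
rewrite mean_iterateE big_tupleS/= exprS invfM [X in X *: _]mulrC.
rewrite -/c -[LHS]scalerA -scalemxAr; set a := _ / n%:R.
rewrite [X in _ = _ + X]scalerA [a * _]mulrC -[X in _ = _ + X]scalerA -scalerDr; congr (_ *: _).
rewrite mulmx_sumr !scaler_sumr -big_split; apply: eq_bigr => t _ /=.
by rewrite card_Sn mean_epoch.
Qed.

End MeanIterate.

(** * Closed form of the error and its splitting along the null space of Z *)

Theorem theorem3p3 (R : realType) (n p B : nat)
  (hn : (1 <= n)%N) (hp : (1 <= p)%N) (hB : (1 <= B)%N) (hBn : (B %| n)%N)
  (part : batch_partition n B)
  (X : 'M[R]_(n, p)) (y : 'cV[R]_n) (betas : 'cV[R]_p) (eta : 'cV[R]_n)
  (hy : y = X *m betas + eta)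
  (alpha : R) (halpha : 0 <= alpha) (beta0 : 'cV[R]_p)
  (d : measure_display) (T : measurableType d) (P : probability T R)
  (tau : nat -> T -> 'S_B) (htau : iid_uniform P tau)
  (hrange : Range (Xtilde part X alpha)^T
            `<=` Range ((Xtilde part X alpha)^T *m X)) :
  let Xt := Xtilde part X alpha in
  let Zm := Zmx part X alpha in
  let M : 'M[R]_p := 1%:M - (B%:R * alpha) *: Zm in
  let P0 : 'M[R]_p := 1%:M - mp_inv Zm *m Zm in
  let PZ : 'M[R]_p := 1%:M - P0 in
  (forall k : nat,
     mean_iterate P part X alpha y tau beta0 k - betas =
       M ^+ k *m (beta0 - betas)
       + n%:R^-1 *: ((1%:M - M ^+ k) *m mp_inv Zm *m Xt^T *m eta))
  /\ [/\ orthogonal_projector P0 (Null Zm),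
         orthogonal_projector PZ (Range Zm^T)
       & orthogonal_projector PZ (Range Zm)]
  /\ (forall k : nat,
        M ^+ k *m (beta0 - betas) =
          P0 *m (beta0 - betas) + M ^+ k *m PZ *m (beta0 - betas)).
Proof.
move=> Xt Zm M P0 PZ.
have [ZGZ _ _ _] := mp_invP Zm.
have n0 : n%:R != 0 :> R by rewrite pnatr_eq0 -lt0n.
have PZE : PZ = mp_inv Zm *m Zm by rewrite /PZ /P0 subKr.
(* Z annihilates [P0], hence [M] fixes it. *)
have MP0 k : M ^+ k *m P0 = P0.
  apply: mulmx_expr_fix; rewrite /M mulmxBl mul1mx -scalemxAl.
  by rewrite mulmx_null_projector scaler0 subr0.
(* The range hypothesis writes [Xt^T *m eta] as [n%:R *: Zm *m v], which [Zm *m mp_inv Zm] fixes. *)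
have ZGw : Zm *m (mp_inv Zm *m (Xt^T *m eta)) = Xt^T *m eta.
  have [|v _ <-] := hrange (Xt^T *m eta); first by exists eta.
  have -> : Xt^T *m X = n%:R *: Zm by rewrite /Zm /Zmx scalerA mulfV// scale1r.
  by rewrite -scalemxAl -!scalemxAr !mulmxA ZGZ.
split; [|split].
- elim=> [|k IH].
    by rewrite mean_iterate0// expr0 subrr !mul0mx scaler0 addr0 mul1mx.
  rewrite mean_iterateS//; set b := mean_iterate _ _ _ _ _ _ _ _ in IH *.
  have -> : y - X *m b = eta - X *m (b - betas).
    by rewrite hy mulmxBr opprB addrCA addrA.
  have -> : b + (B%:R * alpha / n%:R) *: (Xt^T *m (eta - X *m (b - betas))) - betas =
      M *m (b - betas) + n%:R^-1 *: ((B%:R * alpha) *: (Xt^T *m eta)).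
    rewrite mulmxBr mulmxA scalerBr /M mulmxBl mul1mx /Zm /Zmx -/Xt.
    rewrite -!scalemxAl !scalerA [n%:R^-1 * _]mulrC.
    by rewrite addrAC [X in _ + X]addrC addrA.
  rewrite IH mulmxDr exprS -mulmxE mulmxA -addrA; congr (_ + _).
  rewrite -scalemxAr -scalerDr; congr (_ *: _).
  rewrite -!mulmxA; set u := mp_inv Zm *m _.
  (* The forcing term is thus [(1 - M) u], and [M (1 - M^k) u + (1 - M) u = (1 - M^(k+1)) u]. *)
  have Mu : M *m u = u - (B%:R * alpha) *: (Xt^T *m eta).
    by rewrite /M mulmxBl mul1mx -scalemxAl ZGw.
  move: (M) Mu => {IH MP0 P0 PZ PZE}M Mu.
  by rewrite !mulmxBl !mul1mx mulmxBr Mu mulmxA addrAC subrK.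
- split; first exact: null_projectorP.
    by rewrite PZE; exact: row_projectorP.
  have := row_projectorP Zm; rewrite -PZE.
  (* Symmetry of Z identifies its row and column spaces. *)
  by rewrite [Zm^T](tr_Zmx part X alpha hB).
(* Replace [P0] by [M ^+ k *m P0], factor out [M ^+ k], and use that [P0] and [PZ] add up to the
   identity. *)
- move=> k; rewrite -{1}(MP0 k) -!mulmxA -mulmxDr -mulmxDl.
  by rewrite /PZ [P0 + _]addrC subrK mul1mx.
Qed.
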